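(* Let $k$ be a commutative ring of characteristic $0$, let $(A,\mu,\alpha)$ be a (multiplicative) hom-associative algebra over $k$, let $\mathcal O=\{C^p_\alpha(A)\}_{p\ge1}$ be its operad of Hochschild cochains and $\mathcal M=\{A\otimes A^{\otimes n}\}_{n\ge0}$ its Hochschild chains, with the maps $\bullet_i$ ($1\le i\le n-p+1$) described in the context. With the additional maps $\bullet_0:\mathcal O(p)\otimes\mathcal M(n)\to\mathcal M(n-p+1)$, for $p\le n+1$, and $t:\mathcal M(n)\to\mathcal M(n)$ given by $$f\bullet_0(a_0\otimes a_1\cdots a_n)=f(a_0,\dots,a_{p-1})\otimes\alpha^{p-1}(a_p)\cdots\alpha^{p-1}(a_n),\qquad t(a_0\otimes a_1\cdots a_n)=a_n\otimes a_0a_1\cdots a_{n-1},$$ $\mathcal M$ is a cyclic (unital) comp module over $\mathcal O$.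
   Context: All modules, linear maps and tensor products are over $k$. A (multiplicative) hom-associative algebra is a $k$-module $A$ with a bilinear map $\mu:A\otimes A\to A$, $(a,b)\mapsto a\cdot b$, and a linear map $\alpha:A\to A$ with $(a\cdot b)\cdot\alpha(c)=\alpha(a)\cdot(b\cdot c)$ and $\alpha(a\cdot b)=\alpha(a)\cdot\alpha(b)$. The operad $\mathcal O$ is the non-symmetric operad with $\mathcal O(p)=C^p_\alpha(A)=\{f:A^{\otimes p}\to A\mid\alpha\circ f=f\circ\alpha^{\otimes p}\}$, $p\ge1$, partial compositions $$(f\circ_ig)(a_1,\dots,a_{p+q-1})=f(\alpha^{q-1}(a_1),\dots,\alpha^{q-1}(a_{i-1}),g(a_i,\dots,a_{i+q-1}),\alpha^{q-1}(a_{i+q}),\dots,\alpha^{q-1}(a_{p+q-1}))$$ for $f\in\mathcal O(p)$, $g\in\mathcal O(q)$, $1\le i\le p$, and identity element $\mathds 1=\mathrm{id}_A$. $\mathcal M(n)=A\otimes A^{\otimes n}$ with elements written $a_0\otimes a_1\cdots a_n$; for $f\in\mathcal O(p)$, $p\le n$, $1\le i\le n-p+1$, $$f\bullet_i(a_0\otimes a_1\cdots a_n)=\alpha^{p-1}(a_0)\otimes\alpha^{p-1}(a_1)\cdots\alpha^{p-1}(a_{i-1})\,f(a_i,\dots,a_{i+p-1})\,\alpha^{p-1}(a_{i+p})\cdots\alpha^{p-1}(a_n).$$ A cyclic (unital) comp module over an operad $\mathcal O$ is a sequence of $k$-modules $\{\mathcal M(n)\}_{n\ge0}$ with bilinear maps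 $\bullet_i:\mathcal O(p)\otimes\mathcal M(n)\to\mathcal M(n-p+1)$ for $p\le n+1$, $0\le i\le n-p+1$, and linear maps $t:\mathcal M(n)\to\mathcal M(n)$ such that, for $f\in\mathcal O(p)$, $g\in\mathcal O(q)$, $x\in\mathcal M(n)$ and all indices $i,j\ge0$ for which the left-hand side is defined: (1) $f\bullet_i(g\bullet_jx)=g\bullet_j(f\bullet_{i+q-1}x)$ if $j<i$; $\ f\bullet_i(g\bullet_jx)=(f\circ_{j-i+1}g)\bullet_ix$ if $j-p<i\le j$; $\ f\bullet_i(g\bullet_jx)=g\bullet_{j-p+1}(f\bullet_ix)$ if $0\le i\le j-p$; (2) $\mathds 1\bullet_ix=x$ for $i=0,1,\dots,n$; (3) $t^{n+1}=\mathrm{id}$ on $\mathcal M(n)$ for $n\ge1$, and $t(f\bullet_ix)=f\bullet_{i+1}t(x)$ for $i=0,1,\dots,n-p$. *)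

(* Defs.v *)
From HB Require Import structures.
From mathcomp Require Import all_boot all_order all_algebra.
From mathcomp Require Import generic_quotient ring_quotient.
From mathcomp Require Import boolp functions.
From mathcomp.multinomials Require Import freeg.
From mathcomp Require Import zify.

Set Implicit Arguments.
Unset Strict Implicit.
Unset Printing Implicit Defensive.

Import GRing.Theory.
Local Open Scope ring_scope.

Definition is_bilinear (k : comNzRingType) (U V W : lmodType k)
    (f : U -> V -> W) : Prop :=
  (forall v, linear (f^~ v)) /\ (forall u, linear (f u)).

Section TensorPower.
Context (k : comNzRingType) (A : lmodType k) (n : nat).

Definition tset (a : n.-tuple A) (i : 'I_n) (x : A) : n.-tuple A :=
  [tuple if j == i then x else tnth a j | j < n].

Definition multilinear (V : lmodType k) (phi : n.-tuple A -> V) : Prop :=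
  forall (a : n.-tuple A) (i : 'I_n), linear (fun x => phi (tset a i x)).

Local Notation F := {freeg (n.-tuple A) / k}.

(* the submodule of the free module generated by the multilinearity relations *)
Inductive tensor_rel : F -> Prop :=
| tensor_rel0 : tensor_rel 0
| tensor_relD (c : k) (u v : F) :
    tensor_rel u -> tensor_rel v -> tensor_rel (c *: u + v)
| tensor_rel_slot (a : n.-tuple A) (i : 'I_n) (c : k) (x y : A) :
    tensor_rel (<< tset a i (c *: x + y) >>
                - (c *: << tset a i x >> + << tset a i y >>)).

Definition tensor_relb : {pred F} := fun u => `[< tensor_rel u >].

Fact tensor_rel_submod : submod_closed tensor_relb.
Proof.
split; first by apply/asboolP; constructor.
by move=> c u v /asboolP ru /asboolP rv; apply/asboolP; constructor.
Qed.

HB.instance Definition _ :=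
  GRing.isSubmodClosed.Build k F tensor_relb tensor_rel_submod.

Definition tpow : Type := {ideal_quot tensor_relb}.

HB.instance Definition _ := GRing.Zmodule.on tpow.

Local Notation pi := (\pi_({ideal_quot tensor_relb}))%qT.

Definition tpow_scale (c : k) (x : tpow) : tpow := pi (c *: repr x).

Lemma tpow_piE (u v : F) : tensor_rel (u - v) -> pi u = pi v.
Proof.
by move=> ruv; apply/eqP; rewrite -Quotient.idealrBE; apply/asboolP.
Qed.

Lemma tensor_relZ (c : k) (u : F) : tensor_rel u -> tensor_rel (c *: u).
Proof. by move=> ru; rewrite -[c *: u]addr0; do 2?constructor. Qed.

Lemma tensor_rel_repr (u : F) : tensor_rel (repr (pi u) - u).
Proof.
apply/asboolP; change (repr (pi u) - u \in tensor_relb).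
by rewrite Quotient.idealrBE reprK.
Qed.

Lemma tpow_pi_add (u v : F) : (pi u : tpow) + pi v = pi (u + v).
Proof. by rewrite [RHS]Quotient.pi_add. Qed.

Lemma tpow_scale_pi (c : k) (u : F) : tpow_scale c (pi u) = pi (c *: u).
Proof.
rewrite /tpow_scale; apply: tpow_piE; rewrite -scalerBr.
exact/tensor_relZ/tensor_rel_repr.
Qed.

Fact tpow_scaleA a b x : tpow_scale a (tpow_scale b x) = tpow_scale (a * b) x.
Proof. by rewrite -[x]reprK (tpow_scale_pi b) !tpow_scale_pi scalerA. Qed.

Fact tpow_scale1 : left_id 1 tpow_scale.
Proof. by move=> x; rewrite -[x]reprK tpow_scale_pi scale1r. Qed.

Fact tpow_scaleDr : right_distributive tpow_scale +%R.
Proof.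
move=> c x y; rewrite -[x]reprK -[y]reprK.
by rewrite [X in tpow_scale c X]tpow_pi_add !tpow_scale_pi scalerDr tpow_pi_add.
Qed.

Fact tpow_scaleDl x : {morph tpow_scale^~ x : a b / a + b}.
Proof.
by move=> a b; rewrite -[x]reprK !tpow_scale_pi scalerDl tpow_pi_add.
Qed.

HB.instance Definition _ := GRing.Zmodule_isLmodule.Build k tpow
  tpow_scaleA tpow_scale1 tpow_scaleDr tpow_scaleDl.

Lemma tpow_pi_scale (c : k) (u : F) : c *: (pi u : tpow) = pi (c *: u).
Proof. exact: tpow_scale_pi. Qed.

Definition tpure (a : n.-tuple A) : tpow := pi << a >>.

(* The linear map on the tensor power induced by phi; this is linear and      *)
(* sends tpure a to phi a when phi is multilinear (tlift_linear, tliftE), and *)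
(* is only meaningful in this case.                                           *)
Definition tlift (V : lmodType k) (phi : n.-tuple A -> V) (x : tpow) : V :=
  fglift phi (repr x).

Lemma fglift_linear (V : lmodType k) (phi : n.-tuple A -> V) :
  linear (fglift phi).
Proof.
pose L := fglift phi.
have LB : zmod_morphism L by apply: lift_is_additive.
pose LA := GRing.isZmodMorphism.Build _ _ L LB.
pose La : {additive F -> V} := HB.pack L LA.
have LZ c u : La (c *: u) = c *: La u.
  elim/freeg_ind_dom0: u => [|d x D _ _ IH]; first by rewrite scaler0 !raddf0.
  rewrite scalerDr !raddfD IH; congr (_ + _).
  have -> : c *: << d *g x >> = << (c * d) *g x >> :> F.
    by apply/eqP/freeg_eqP => y; rewrite coeffZ !coeffU mulrA.
  by rewrite -![La _]/(fglift phi _) !liftU /= scalerA.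
by move=> c u v; rewrite -[fglift phi _]/(La _) raddfD LZ.
Qed.

Section Lift.
Context (V : lmodType k) (phi : n.-tuple A -> V).
Hypothesis phi_lin : multilinear phi.

Lemma fglift_rel (u : F) : tensor_rel u -> fglift phi u = 0.
Proof.
have LB : zmod_morphism (fglift phi) by apply: lift_is_additive.
elim=> [|c v w _ IHv _ IHw|a i c x y].
- by rewrite -[0 in LHS](subrr 0) LB subrr.
- by rewrite fglift_linear IHv IHw scaler0 addr0.
- by rewrite LB fglift_linear !liftU !scale1r (phi_lin a i) subrr.
Qed.

Lemma tlift_pi (u : F) : tlift phi (pi u) = fglift phi u.
Proof.
have LB : zmod_morphism (fglift phi) by apply: lift_is_additive.
apply/eqP; rewrite -subr_eq0 /tlift -LB.
exact/eqP/fglift_rel/tensor_rel_repr.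
Qed.

Lemma tliftE (a : n.-tuple A) : tlift phi (tpure a) = phi a.
Proof. by rewrite tlift_pi liftU scale1r. Qed.

Lemma tlift_linear : linear (tlift phi).
Proof.
move=> c x y; rewrite -[x]reprK -[y]reprK tpow_pi_scale tpow_pi_add.
by rewrite !tlift_pi fglift_linear.
Qed.

End Lift.

Lemma tpure_multilinear : multilinear tpure.
Proof.
move=> a i c x y; rewrite tpow_pi_scale tpow_pi_add.
exact/tpow_piE/tensor_rel_slot.
Qed.

Lemma tpow_ext (V : lmodType k) (f g : tpow -> V) :
  linear f -> linear g -> (forall a, f (tpure a) = g (tpure a)) -> f =1 g.
Proof.
move=> f_lin g_lin fg x; rewrite -[x]reprK.
elim/freeg_ind_dom0: (repr x) => [|d a D _ _ IH].
  have -> : pi 0 = (-1) *: (0 : tpow) + 0.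
    by rewrite scaler0 addr0 -[RHS](scale0r (pi 0 : tpow)) tpow_pi_scale scaler0.
  by rewrite f_lin g_lin !scaleN1r !addNr.
have -> : pi (<< d *g a >> + D) = d *: tpure a + pi D.
  rewrite tpow_pi_scale tpow_pi_add; congr (pi (_ + _)).
  by apply/eqP/freeg_eqP => y; rewrite coeffZ !coeffU mul1r.
by rewrite f_lin g_lin fg IH.
Qed.

End TensorPower.

Section PureTensors.
Context (k : comNzRingType) (A : lmodType k).
Implicit Types (a : nat -> A) (n : nat).

(* a 0 (x) a 1 (x) ... (x) a n.-1; the other values of a are irrelevant *)
Definition ptens n a : tpow A n := tpure [tuple a j | j < n].

Definition upd a (l : nat) (x : A) : nat -> A :=
  fun j => if j == l then x else a j.

Lemma eq_ptens n a b : (forall j, (j < n)%N -> a j = b j) -> ptens n a = ptens n b.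
Proof. by move=> ab; congr tpure; apply: eq_mktuple => j; apply: ab. Qed.

Lemma tpureE n (a : n.-tuple A) : tpure a = ptens n (nth 0 a).
Proof.
by congr tpure; apply: eq_from_tnth => j; rewrite tnth_mktuple (tnth_nth 0).
Qed.

Lemma nth_mktuple0 n a j : (j < n)%N -> nth 0 [tuple a i | i < n] j = a j.
Proof. by move=> jn; rewrite -[j]/(val (Ordinal jn)) -tnth_nth tnth_mktuple. Qed.

Lemma ptens_upd n a l : (l < n)%N -> linear (fun x => ptens n (upd a l x)).
Proof.
move=> ln; have E x : ptens n (upd a l x)
    = tpure (tset [tuple a j | j < n] (Ordinal ln) x).
  by congr tpure; apply: eq_mktuple => j; rewrite tnth_mktuple.
by move=> c x y; rewrite !E tpure_multilinear.
Qed.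

Lemma multilinearP n (V : lmodType k) (phi : (nat -> A) -> V) :
  (forall a b, (forall j, (j < n)%N -> a j = b j) -> phi a = phi b) ->
  (forall a l, (l < n)%N -> linear (fun x => phi (upd a l x))) ->
  multilinear (fun a : n.-tuple A => phi (nth 0 a)).
Proof.
move=> phiE phiL a i c x y.
have E z : phi (nth 0 (tset a i z)) = phi (upd (nth 0 a) i z).
  apply: phiE => j jn; rewrite -[j]/(val (Ordinal jn)) -tnth_nth tnth_mktuple.
  by rewrite /upd (tnth_nth 0).
by rewrite !E; apply: phiL.
Qed.

Lemma tpow_extP n (V : lmodType k) (f g : tpow A n -> V) :
  linear f -> linear g -> (forall a, f (ptens n a) = g (ptens n a)) -> f =1 g.
Proof.
by move=> fL gL fg; apply: tpow_ext => // a; rewrite tpureE fg.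
Qed.

End PureTensors.

(* Equality of elements of a family F indexed by nat, up to the canonical     *)
(* identification of F m and F n when m = n; needed as e.g. p + (q + r).-1    *)
(* and (p + q).-1 + r are only propositionally equal.                         *)
Definition eq_fam (k : comNzRingType) (F : nat -> lmodType k) m n
    (x : F m) (y : F n) : Prop :=
  existT (fun l => F l : Type) m x = existT (fun l => F l : Type) n y.

Notation "x =[ F ]= y" := (@eq_fam _ F _ _ x y)
  (at level 70, F at level 0, no associativity, format "x  =[ F ]=  y").

(* Non-symmetric k-linear operads, without operations of arity 0: only the    *)
(* values op p with 0 < p and the compositions op_comp p q i with 0 < q and   *)
(* 1 <= i <= p are constrained, the others are junk.                          *)
Record operad (k : comNzRingType) := Operad {
  op :> nat -> lmodType k;
  op_comp : forall p q : nat, nat -> op p -> op q -> op (p + q).-1;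
  op_id : op 1;
  op_comp_bilinear : forall p q i, (0 < q)%N -> (0 < i <= p)%N ->
    is_bilinear (@op_comp p q i);
  op_comp_seq : forall p q r i j (f : op p) (g : op q) (h : op r),
    (0 < r)%N -> (0 < i <= p)%N -> (0 < j <= q)%N ->
    op_comp (i + j).-1 (op_comp i f g) h =[op]= op_comp i f (op_comp j g h);
  op_comp_par : forall p q r i j (f : op p) (g : op q) (h : op r),
    (0 < q)%N -> (0 < r)%N -> (0 < i)%N -> (i < j)%N -> (j <= p)%N ->
    op_comp (j + q).-1 (op_comp i f g) h =[op]= op_comp i (op_comp j f h) g;
  op_comp_id_l : forall p (f : op p), (0 < p)%N -> op_comp 1 op_id f =[op]= f;
  op_comp_id_r : forall p i (f : op p), (0 < i <= p)%N ->
    op_comp i f op_id =[op]= f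
}.

(* f in O(p) acts on M(n) at position i *)
Definition bullet_dom (p n i : nat) : bool :=
  [&& 0 < p, p <= n.+1 & i <= n.+1 - p]%N.

Record is_cyclic_comp_module (k : comNzRingType) (O : operad k)
    (M : nat -> lmodType k)
    (bullet : forall p n : nat, nat -> O p -> M n -> M (n.+1 - p)%N)
    (t : forall n : nat, M n -> M n) : Prop := CyclicCompModule {
  bullet_bilinear : forall p n i, bullet_dom p n i ->
    is_bilinear (bullet p n i);
  cyclic_linear : forall n, linear (t n);
  bullet_lt : forall p q n i j (f : O p) (g : O q) (x : M n),
    bullet_dom q n j -> bullet_dom p (n.+1 - q) i ->
    (j < i)%N ->
    bullet p _ i f (bullet q n j g x)
      =[M]= bullet q _ j g (bullet p n (i + q).-1 f x);
  bullet_comp : forall p q n i j (f : O p) (g : O q) (x : M n),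
    bullet_dom q n j -> bullet_dom p (n.+1 - q) i ->
    (i <= j)%N -> (j < i + p)%N ->
    bullet p _ i f (bullet q n j g x)
      =[M]= bullet _ n i (op_comp (j - i).+1 f g) x;
  bullet_gt : forall p q n i j (f : O p) (g : O q) (x : M n),
    bullet_dom q n j -> bullet_dom p (n.+1 - q) i ->
    (i + p <= j)%N ->
    bullet p _ i f (bullet q n j g x)
      =[M]= bullet q _ (j - p).+1 g (bullet p n i f x);
  bullet_id : forall n i (x : M n), (i <= n)%N ->
    bullet 1 n i (op_id O) x =[M]= x;
  cyclic_order : forall n (x : M n), (0 < n)%N -> iter n.+1 (t n) x = x;
  cyclic_bullet : forall p n i (f : O p) (x : M n),
    (0 < p)%N -> (i + p <= n)%N ->
    t _ (bullet p n i f x) = bullet p n i.+1 f (t n x)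
}.

Record is_hom_assoc (k : comNzRingType) (A : lmodType k) (mu : A -> A -> A)
    (alpha : A -> A) : Prop := HomAssoc {
  hom_mul_bilinear : is_bilinear mu;
  hom_assoc : forall a b c, mu (mu a b) (alpha c) = mu (alpha a) (mu b c);
  hom_mul : forall a b, alpha (mu a b) = mu (alpha a) (alpha b)
}.

Section Hochschild.
Context (k : comNzRingType) (A : lmodType k) (alpha : {linear A -> A}).
Implicit Types (a : nat -> A) (n p q r : nat).

Lemma iter_alpha_linear n : linear (iter n alpha).
Proof. by elim: n => [|n IH] c x y //=; rewrite IH linearP. Qed.

(* the tensor power of the map alpha *)
Definition tpow_map n : tpow A n -> tpow A n :=
  tlift (fun a : n.-tuple A => ptens n (fun j => alpha (nth 0 a j))).

Lemma tpow_map_multilinear n :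
  multilinear (fun a : n.-tuple A => ptens n (fun j => alpha (nth 0 a j))).
Proof.
apply: (multilinearP (phi := fun a => ptens n (fun j => alpha (a j)))).
  by move=> a b ab; apply: eq_ptens => j /ab ->.
move=> a l ln c x y.
have E z : ptens n (fun j => alpha (upd a l z j))
    = ptens n (upd (fun j => alpha (a j)) l (alpha z)).
  by apply: eq_ptens => j _; rewrite /upd; case: eqP.
by rewrite !E linearP ptens_upd.
Qed.

Lemma tpow_map_linear n : linear (@tpow_map n).
Proof. exact/tlift_linear/tpow_map_multilinear. Qed.

Lemma tpow_mapE n a : tpow_map (ptens n a) = ptens n (fun j => alpha (a j)).
Proof.
rewrite /tpow_map tliftE; last exact: tpow_map_multilinear.
by apply: eq_ptens => j jn; rewrite nth_mktuple0.
Qed.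

Definition is_cochain p (f : tpow A p -> A) : Prop :=
  linear f /\ forall x, alpha (f x) = f (tpow_map x).

Definition cochainb p : {pred (tpow A p -> A)} := fun f => `[< is_cochain f >].

Fact cochain_submod p : submod_closed (@cochainb p).
Proof.
split; first by apply/asboolP; split=> [c x y|x] /=; rewrite ?scaler0 ?addr0 ?raddf0.
move=> c f g /asboolP[fL fa] /asboolP[gL ga]; apply/asboolP; split=> [d x y|x].
  rewrite !fctE fL gL !scalerDr !scalerA [c * d]mulrC -!addrA; congr (_ + _).
  by rewrite addrCA.
by rewrite !fctE linearP fa ga.
Qed.

HB.instance Definition _ p :=
  GRing.isSubmodClosed.Build k (tpow A p -> A) (@cochainb p) (@cochain_submod p).

Record cochain p := Cochain {
  cochain_fun :> tpow A p -> A;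
  cochain_funP : cochain_fun \in @cochainb p
}.

HB.instance Definition _ p := [isSub for @cochain_fun p].
HB.instance Definition _ p := [Choice of cochain p by <:].
HB.instance Definition _ p := [SubChoice_isSubLmodule of cochain p by <:].

Lemma cochain_linear p (f : cochain p) : linear f.
Proof. by have /asboolP[] := cochain_funP f. Qed.

Lemma cochain_alpha p (f : cochain p) x : alpha (f x) = f (tpow_map x).
Proof. by have /asboolP[_ ->] := cochain_funP f. Qed.

Lemma eq_cochain p p' (f : cochain p) (g : cochain p') : p = p' ->
  (forall a, f (ptens p a) = g (ptens p' a)) ->
  @eq_fam k cochain _ _ f g.
Proof.
move=> pp'; case: _ / pp' g => g fg; congr existT; apply/val_inj/funext.
exact: (tpow_extP (cochain_linear f) (cochain_linear g)).
Qed.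

(* Slot j of the tensor obtained from a_0, a_1, ... by inserting g at the     *)
(* consecutive slots i, ..., i + q - 1 and alpha^(q - 1) at all others.       *)
Definition ins_term q (g : tpow A q -> A) (i : nat) (a : nat -> A) (j : nat) : A :=
  if (j < i)%N then iter q.-1 alpha (a j)
  else if j == i then g (ptens q (fun l => a (i + l)%N))
  else iter q.-1 alpha (a (j + q.-1)%N).

Definition insertion q (g : tpow A q -> A) (i N m : nat) : tpow A N -> tpow A m :=
  tlift (fun a : N.-tuple A => ptens m (ins_term g i (nth 0 a))).

Section Insertion.
Variables (q : nat) (g : tpow A q -> A) (i N m : nat).
Hypotheses (g_lin : linear g) (q_gt0 : (0 < q)%N) (im : (i < m)%N)
  (mq : (m + q = N.+1)%N).

Lemma eq_ins_term a b : (forall j, (j < N)%N -> a j = b j) ->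
  forall j, (j < m)%N -> ins_term g i a j = ins_term g i b j.
Proof.
move=> ab j jm; rewrite /ins_term; case: ltnP => ij; first by rewrite ab //; lia.
case: eqP => [_|ji]; last by rewrite ab //; lia.
by congr g; apply: eq_ptens => l lq; rewrite ab //; lia.
Qed.

Lemma insertion_multilinear :
  multilinear (fun a : N.-tuple A => ptens m (ins_term g i (nth 0 a))).
Proof.
apply: (multilinearP (phi := fun a => ptens m (ins_term g i a))).
  by move=> a b ab; apply/eq_ptens/eq_ins_term.
move=> a l lN c x y; have [li|il] := ltnP l i.
  have E z : ptens m (ins_term g i (upd a l z))
      = ptens m (upd (ins_term g i a) l (iter q.-1 alpha z)).
    apply: eq_ptens => j jm; rewrite /ins_term /upd.
    case: (ltnP j i) => ij; first by case: eqP.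
    have -> : (j == l) = false by lia.
    have -> : (j + q.-1 == l)%N = false by lia.
    by case: eqP => // _; congr g; apply: eq_ptens => s sq; case: eqP => //; lia.
  by rewrite !E iter_alpha_linear ptens_upd //; lia.
have [lq|ql] := ltnP l (i + q).
  have E z : ptens m (ins_term g i (upd a l z)) = ptens m (upd (ins_term g i a) i
      (g (ptens q (upd (fun s => a (i + s)%N) (l - i)%N z)))).
    apply: eq_ptens => j jm; rewrite /ins_term /upd.
    case: (ltnP j i) => ij; first by do 2![case: eqP => [?|_]; first lia].
    case: eqP => [_|ji]; last by case: eqP => //; lia.
    congr g; apply: eq_ptens => s sq.
    by have -> : (i + s == l)%N = (s == l - i)%N by lia.
  have li : (l - i < q)%N by lia.
  by rewrite !E (ptens_upd _ li) g_lin ptens_upd.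
have E z : ptens m (ins_term g i (upd a l z))
    = ptens m (upd (ins_term g i a) (l - q.-1)%N (iter q.-1 alpha z)).
  apply: eq_ptens => j jm; rewrite /ins_term /upd.
  case: (ltnP j i) => ij; first by do 2![case: eqP => [?|_]; first lia].
  case: eqP => [ji|ji].
    case: eqP => [?|_]; first lia.
    by congr g; apply: eq_ptens => s sq; case: eqP => //; lia.
  have -> : (j + q.-1 == l)%N = (j == l - q.-1)%N by lia.
  by case: eqP.
by rewrite !E iter_alpha_linear ptens_upd //; lia.
Qed.

Lemma insertion_linear : linear (@insertion q g i N m).
Proof. exact/tlift_linear/insertion_multilinear. Qed.

Lemma insertionE a :
  @insertion q g i N m (ptens N a) = ptens m (ins_term g i a).
Proof.
rewrite /insertion tliftE; last exact: insertion_multilinear.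
by apply/eq_ptens/eq_ins_term => j jN; rewrite nth_mktuple0.
Qed.

End Insertion.

Lemma insertion_map q (g : cochain q) i N m x :
  (0 < q)%N -> (i < m)%N -> (m + q = N.+1)%N ->
  tpow_map (@insertion q g i N m x) = insertion g i m (tpow_map x).
Proof.
move=> q0 im mq; move: x; have gL := @cochain_linear _ g; apply: tpow_extP.
- by move=> c x y; rewrite insertion_linear // tpow_map_linear.
- by move=> c x y; rewrite tpow_map_linear insertion_linear.
move=> a; rewrite tpow_mapE !insertionE // tpow_mapE; apply: eq_ptens => j jm.
rewrite /ins_term; case: ltnP => _; first by rewrite -iterS iterSr.
by case: eqP => [_|_]; [rewrite cochain_alpha tpow_mapE | rewrite -iterS iterSr].
Qed.

(* The composition f o_i g for 1 <= i <= p and 0 < q (where the inserted map  *)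
(* is indeed a cochain), and junk otherwise. Positions of tensor factors      *)
(* are counted from 0, whence the predecessor of i.                           *)
Definition hoch_comp p q (i : nat) (f : cochain p) (g : cochain q) :
    cochain (p + q).-1 :=
  insubd 0 (fun x : tpow A (p + q).-1 => f (insertion g i.-1 p x)).

Lemma hoch_comp_val p q i (f : cochain p) (g : cochain q) x :
  (0 < q)%N -> (0 < i <= p)%N ->
  hoch_comp i f g x = f (insertion g i.-1 p x).
Proof.
move=> q0 ip; rewrite /hoch_comp -[cochain_fun _]/(val _) val_insubd.
case: ifPn => // /negP[]; apply/asboolP.
have gL := @cochain_linear _ g.
split=> [c u v|u]; first by rewrite insertion_linear ?cochain_linear //; lia.
by rewrite cochain_alpha insertion_map //; lia.
Qed.

Lemma hoch_compE p q i (f : cochain p) (g : cochain q) a :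
  (0 < q)%N -> (0 < i <= p)%N ->
  hoch_comp i f g (ptens _ a) = f (ptens p (ins_term g i.-1 a)).
Proof.
move=> q0 ip; rewrite hoch_comp_val // insertionE //; try lia.
exact: cochain_linear.
Qed.

Fact hoch_id_multilinear : multilinear (fun a : 1.-tuple A => nth 0 a 0).
Proof.
apply: (multilinearP (phi := fun a => a 0%N)); first by move=> a b; apply.
by move=> a [|//] _ c x y.
Qed.

Lemma hoch_id_tlift a :
  tlift (fun a : 1.-tuple A => nth 0 a 0) (ptens 1 a) = a 0%N.
Proof.
rewrite tliftE; first exact: nth_mktuple0.
exact: hoch_id_multilinear.
Qed.

Fact hoch_id_cochain : tlift (fun a : 1.-tuple A => nth 0 a 0) \in @cochainb 1.
Proof.
have L := tlift_linear hoch_id_multilinear.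
apply/asboolP; split; first exact: L.
apply: tpow_extP => [c x y|c x y|a]; first by rewrite L linearP.
  by rewrite tpow_map_linear L.
by rewrite tpow_mapE !hoch_id_tlift.
Qed.

(* the identity of A, seen as a map on the first tensor power of A *)
Definition hoch_id : cochain 1 := Cochain hoch_id_cochain.

Lemma hoch_idE a : hoch_id (ptens 1 a) = a 0%N.
Proof. exact: hoch_id_tlift. Qed.

Lemma cochain_lin_val p (c : k) (f g : cochain p) x :
  (c *: f + g) x = c *: f x + g x.
Proof. by []. Qed.

Lemma ins_term_upd q (g : tpow A q -> A) i a m :
  ptens m (ins_term g i a)
    = ptens m (upd (ins_term (fun _ : tpow A q => 0) i a) i (g (ptens q (fun l => a (i + l)%N)))).
Proof.
apply: eq_ptens => j _; rewrite /upd /ins_term; case: eqP => // ->.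
by rewrite ltnn.
Qed.

Fact hoch_comp_bilinear p q i : (0 < q)%N -> (0 < i <= p)%N ->
  is_bilinear (@hoch_comp p q i).
Proof.
move=> q0 ip; split=> [g c f f'|f c g g']; apply/val_inj/funext => x.
  change (hoch_comp i (c *: f + f') g x = (c *: hoch_comp i f g + hoch_comp i f' g) x).
  by rewrite cochain_lin_val !hoch_comp_val.
change (hoch_comp i f (c *: g + g') x = (c *: hoch_comp i f g + hoch_comp i f g') x).
move: x; apply: tpow_extP => [||a]; [exact: cochain_linear..|].
rewrite cochain_lin_val !hoch_compE // ins_term_upd cochain_lin_val.
rewrite ptens_upd; last lia.
by rewrite cochain_linear -!ins_term_upd.
Qed.

Fact hoch_comp_seq p q r i j (f : cochain p) (g : cochain q) (h : cochain r) :
  (0 < r)%N -> (0 < i <= p)%N -> (0 < j <= q)%N ->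
  @eq_fam k cochain _ _ (hoch_comp (i + j).-1 (hoch_comp i f g) h)
                        (hoch_comp i f (hoch_comp j g h)).
Proof.
move=> r0 ip jq; apply: eq_cochain => [|a]; first lia.
rewrite !hoch_compE; try lia.
congr (f _); apply: eq_ptens => s sp; rewrite {1 3}/ins_term.
case: ltnP => si.
  rewrite /ins_term ifT; last lia.
  by rewrite -iterD; congr iter; lia.
case: eqP => si'.
  rewrite hoch_compE; try lia.
  congr (g _); apply: eq_ptens => l lq; rewrite /ins_term.
  have -> : (i.-1 + l < (i + j).-1.-1)%N = (l < j.-1)%N by lia.
  have -> : (i.-1 + l == (i + j).-1.-1)%N = (l == j.-1)%N by lia.
  case: ltnP => // _; case: eqP => [_|_]; last by rewrite addnA.
  by congr (h _); apply: eq_ptens => l' _; congr a; lia.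
rewrite /ins_term ifF; last lia.
rewrite ifF; last lia.
by rewrite -iterD; congr iter; [|congr a]; lia.
Qed.

Lemma iter_alphaC m n x : iter m alpha (iter n alpha x) = iter n alpha (iter m alpha x).
Proof. by rewrite -!iterD addnC. Qed.

Lemma cochain_iter p (f : cochain p) n a :
  iter n alpha (f (ptens p a)) = f (ptens p (fun j => iter n alpha (a j))).
Proof.
elim: n => [|n IH] //=; rewrite IH cochain_alpha tpow_mapE.
exact: (congr1 f).
Qed.

Fact hoch_comp_par p q r i j (f : cochain p) (g : cochain q) (h : cochain r) :
  (0 < q)%N -> (0 < r)%N -> (0 < i)%N -> (i < j)%N -> (j <= p)%N ->
  @eq_fam k cochain _ _ (hoch_comp (j + q).-1 (hoch_comp i f g) h)
                        (hoch_comp i (hoch_comp j f h) g).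
Proof.
move=> q0 r0 i0 ij jp; apply: eq_cochain => [|a]; first lia.
rewrite !hoch_compE; try lia.
congr (f _); apply: eq_ptens => s sp.
have [si|si] := ltnP s i.-1.
  rewrite /ins_term !ifT; try lia.
  exact: iter_alphaC.
have [->|si'] := eqVneq s i.-1.
  rewrite /ins_term ltnn eqxx ifT; last lia.
  rewrite cochain_iter; congr (g _); apply: eq_ptens => l lq.
  by rewrite ifT //; lia.
have E b l : (s <= l)%N -> ins_term g i.-1 b l = iter q.-1 alpha (b (l + q.-1)%N).
  by move=> sl; rewrite /ins_term !ifF //; lia.
rewrite E //; move: (ins_term g i.-1 a) (E a) => b H; rewrite /ins_term.
have -> : (s + q.-1 < (j + q).-1.-1)%N = (s < j.-1)%N by lia.
have -> : (s + q.-1 == (j + q).-1.-1)%N = (s == j.-1)%N by lia.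
case: ltnP => sj; first by rewrite H // iter_alphaC.
case: eqP => sj'; last by rewrite H ?leq_addr // iter_alphaC addnAC.
rewrite cochain_iter; congr (h _); apply: eq_ptens => l lr.
by rewrite H; [congr (iter _ _ (a _))|]; lia.
Qed.

Fact hoch_comp_id_l p (f : cochain p) : (0 < p)%N ->
  @eq_fam k cochain _ _ (hoch_comp 1 hoch_id f) f.
Proof.
move=> p0; apply: eq_cochain => [|a]; first lia.
by rewrite hoch_compE // hoch_idE.
Qed.

Fact hoch_comp_id_r p i (f : cochain p) : (0 < i <= p)%N ->
  @eq_fam k cochain _ _ (hoch_comp i f hoch_id) f.
Proof.
move=> ip; apply: eq_cochain => [|a]; first lia.
rewrite hoch_compE //; congr (f _); apply: eq_ptens => j jp.
rewrite /ins_term hoch_idE /= !addn0.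
by case: ltnP => // _; case: eqP => [->|].
Qed.

Definition hoch_operad : operad k :=
  @Operad k cochain hoch_comp hoch_id hoch_comp_bilinear hoch_comp_seq
    hoch_comp_par hoch_comp_id_l hoch_comp_id_r.

(* A (x) A^(x)n, realized as the (n + 1)-st tensor power of A; the tensor     *)
(* a_0 (x) a_1 ... a_n is ptens n.+1 a.                                       *)
Definition hoch_chains (n : nat) : lmodType k := tpow A n.+1.

(* One formula for all i, cf. hoch_bullet0E and hoch_bulletE; junk outside    *)
(* bullet_dom p n i.                                                          *)
Definition hoch_bullet (p n i : nat) (f : hoch_operad p) :
    hoch_chains n -> hoch_chains (n.+1 - p) :=
  insertion (f : cochain p) i (n.+1 - p).+1.

Definition hoch_t (n : nat) : hoch_chains n -> hoch_chains n :=
  tlift (fun a : n.+1.-tuple A =>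
    ptens n.+1 (fun j => if j is j'.+1 then nth 0 a j' else nth 0 a n)).

Lemma hoch_bullet0E p n (f : cochain p) a : (0 < p <= n.+1)%N ->
  hoch_bullet 0 f (ptens n.+1 a) =
  ptens (n.+1 - p).+1 (fun j => if j == 0%N then f (ptens p a)
                                else iter p.-1 alpha (a (j + p.-1)%N)).
Proof.
move=> pn; rewrite /hoch_bullet insertionE //; try lia.
exact: cochain_linear.
Qed.

Lemma hoch_bulletE p n i (f : cochain p) a : bullet_dom p n i ->
  hoch_bullet i f (ptens n.+1 a) =
  ptens (n.+1 - p).+1 (fun j =>
    if (j < i)%N then iter p.-1 alpha (a j)
    else if j == i then f (ptens p (fun l => a (i + l)%N))
    else iter p.-1 alpha (a (j + p.-1)%N)).
Proof.
rewrite /bullet_dom => pn; rewrite /hoch_bullet insertionE //; try lia.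
exact: cochain_linear.
Qed.

Lemma hoch_t_multilinear n : multilinear (fun a : n.+1.-tuple A =>
  ptens n.+1 (fun j => if j is j'.+1 then nth 0 a j' else nth 0 a n)).
Proof.
apply: (multilinearP (phi := fun a =>
  ptens n.+1 (fun j => if j is j'.+1 then a j' else a n))).
  by move=> a b ab; apply: eq_ptens => -[|j] jn; rewrite ab //; lia.
move=> a l ln c x y; pose rl := if l == n then 0%N else l.+1.
have E z : ptens n.+1 (fun j => if j is j'.+1 then upd a l z j' else upd a l z n)
    = ptens n.+1 (upd (fun j => if j is j'.+1 then a j' else a n) rl z).
  apply: eq_ptens => -[|j] jn; rewrite /upd /rl; case: (l =P n) => [->|ln'].
  - by rewrite eqxx.
  - by case: eqP => // nl; case: ln'.
  - by case: eqP => // jn'; move: jn; rewrite jn' ltnn.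
  - by rewrite eqSS.
by rewrite !E ptens_upd // /rl; case: eqP; lia.
Qed.

Lemma hoch_tE n a : hoch_t (ptens n.+1 a) =
  ptens n.+1 (fun j => if j is j'.+1 then a j' else a n).
Proof.
rewrite /hoch_t tliftE; last exact: hoch_t_multilinear.
by apply: eq_ptens => -[|j] jn; rewrite nth_mktuple0 //; lia.
Qed.

End Hochschild.

Arguments hoch_chains {k} A n.
Arguments hoch_t {k A} n _.
Arguments hoch_bullet {k A} alpha p n i f _.

(* Main.v *)
Require Import Defs.
From mathcomp Require Import all_boot all_order all_algebra.
From mathcomp Require Import zify.

Set Implicit Arguments.
Unset Strict Implicit.
Unset Printing Implicit Defensive.

Import GRing.Theory.
Local Open Scope ring_scope.

(* All the maps involved are linear, so the identities are checked on pure
   tensors, slot by slot; since cochains commute with alpha, the powers of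
   alpha produced by one insertion can be moved through the other one. *)

Section CyclicCompModule.
Context (k : comNzRingType) (A : lmodType k) (alpha : {linear A -> A}).
Implicit Types (a : nat -> A) (n p q i j : nat).

(** Destructing [m = m'] puts both images in one space, where agreement on pure tensors suffices.
    The sequences [b] and [b'] are left existential so that unification supplies them once both
    images have been rewritten as [ptens]. *)
Lemma eq_chains_fam n m m' (u : hoch_chains A n -> hoch_chains A m)
    (v : hoch_chains A n -> hoch_chains A m') x :
  linear u -> linear v -> m = m' ->
  (forall a, exists b b' : nat -> A,
    [/\ u (ptens n.+1 a) = ptens m.+1 b, v (ptens n.+1 a) = ptens m'.+1 b'
      & forall s, (s <= m)%N -> b s = b' s]) ->
  u x =[hoch_chains A]= v x.
Proof.
move=> uL + mm'; case: _ / mm' v => v vL uv; congr existT.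
move: x; apply: (tpow_extP uL vL) => a; have [b [b' [-> -> bb']]] := uv a.
exact: eq_ptens.
Qed.

Lemma hoch_bullet_linear p n i (f : cochain alpha p) :
  bullet_dom p n i -> linear (hoch_bullet alpha p n i f).
Proof.
rewrite /bullet_dom => pni; apply: insertion_linear; try lia.
exact: cochain_linear.
Qed.

Lemma hoch_bullet_ptens p n i (f : cochain alpha p) a :
  bullet_dom p n i ->
  hoch_bullet alpha p n i f (ptens n.+1 a)
    = ptens (n.+1 - p).+1 (ins_term alpha f i a).
Proof. exact: hoch_bulletE. Qed.

(** The two blocks are disjoint. Since [g] contracts [q] slots to one on the left of the block of
    [f], slot [i] after the insertion of [g] is slot [i + q - 1] before it. No chain length
    enters. *)
Lemma ins_term_ltC p q (f : cochain alpha p) (g : cochain alpha q) i j a s :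
  (0 < p)%N -> (0 < q)%N -> (j < i)%N ->
  ins_term alpha f i (ins_term alpha g j a) s
    = ins_term alpha g j (ins_term alpha f (i + q).-1 a) s.
Proof.
move=> p0 q0 ji.
have [sj|sj] := ltnP s j.
  by rewrite /ins_term !ifT; try lia; exact: iter_alphaC.
have [->|sj'] := eqVneq s j.
  rewrite /ins_term ltnn eqxx ji cochain_iter.
  by congr (g _); apply: eq_ptens => l lq; rewrite ifT //; lia.
(* Beyond slot [j], inserting [g] only shifts by [q - 1] and applies powers of [alpha]. [E] serves
   twice: for the outer insertion on the right, and for the inner one on the left, which is then
   abstracted as [b]. *)
have E b l : (s <= l)%N ->
    ins_term alpha g j b l = iter q.-1 alpha (b (l + q.-1)%N).
  by move=> sl; rewrite /ins_term !ifF //; lia.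
rewrite E //; move: (ins_term alpha g j a) (E a) => b H; rewrite /ins_term.
have -> : (s + q.-1 < (i + q).-1)%N = (s < i)%N by lia.
have -> : (s + q.-1 == (i + q).-1)%N = (s == i)%N by lia.
case: ltnP => si; first by rewrite H // iter_alphaC.
case: eqP => si'; last by rewrite H ?leq_addr // iter_alphaC addnAC.
rewrite cochain_iter; congr (f _); apply: eq_ptens => l lp.
by rewrite H; [congr (iter _ _ (a _))|]; lia.
Qed.

(** Outside the block of [f] the exponents of [alpha] add up: [(p - 1) + (q - 1) = (p + q - 1) - 1].
    Inside it, [g] fills the argument of [f] numbered [j - i] from 0, hence [(j - i).+1] for
    [hoch_comp], which counts from 1. *)
Lemma ins_term_comp p q (f : cochain alpha p) (g : cochain alpha q) i j a s :
  (0 < q)%N -> (i <= j)%N -> (j < i + p)%N ->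
  ins_term alpha f i (ins_term alpha g j a) s
    = ins_term alpha (hoch_comp (j - i).+1 f g) i a s.
Proof.
move=> q0 ij jp; rewrite [LHS]/ins_term [RHS]/ins_term.
case: ltnP => si.
  rewrite /ins_term ifT; last lia.
  by rewrite -iterD; congr iter; lia.
case: eqP => si'.
  rewrite hoch_compE; try lia.
  congr (f _); apply: eq_ptens => l lp; rewrite /ins_term /=.
  have -> : (i + l < j)%N = (l < j - i)%N by lia.
  have -> : (i + l == j)%N = (l == j - i)%N by lia.
  case: ltnP => // _; case: eqP => [_|_]; last by rewrite addnA.
  by congr (g _); apply: eq_ptens => l' _; congr a; lia.
rewrite /ins_term ifF; last lia.
rewrite ifF; last lia.
by rewrite -iterD; congr iter; [|congr a]; lia.
Qed.

Lemma hoch_bullet_bilinear p n i : bullet_dom p n i ->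
  is_bilinear (hoch_bullet alpha p n i).
Proof.
move=> pni; split=> [x c f g|f]; last exact: hoch_bullet_linear.
have L h := hoch_bullet_linear h pni.
move: x; apply: tpow_extP => [|c' x y|a]; first exact: L.
  rewrite !L !scalerDr !scalerA (mulrC c) -!addrA; congr (_ + _).
  by rewrite addrCA.
(* The cochain enters slot [i] only, so linearity in it is linearity of a pure tensor in that
   slot. *)
rewrite !hoch_bullet_ptens // ins_term_upd cochain_lin_val ptens_upd.
  by rewrite -!ins_term_upd.
by move: pni; rewrite /bullet_dom; lia.
Qed.

Lemma hoch_bullet_lt p q n i j (f : cochain alpha p) (g : cochain alpha q)
    (x : hoch_chains A n) :
  bullet_dom q n j -> bullet_dom p (n.+1 - q) i -> (j < i)%N ->
  hoch_bullet alpha p _ i f (hoch_bullet alpha q n j g x)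
    =[hoch_chains A]=
  hoch_bullet alpha q _ j g (hoch_bullet alpha p n (i + q).-1 f x).
Proof.
move=> dg df ji.
have df' : bullet_dom p n (i + q).-1 by move: dg df; rewrite /bullet_dom; lia.
have dg' : bullet_dom q (n.+1 - p) j by move: dg df; rewrite /bullet_dom; lia.
apply: (eq_chains_fam
  (u := fun x => hoch_bullet alpha p _ i f (hoch_bullet alpha q n j g x))
  (v := fun x => hoch_bullet alpha q _ j g
                   (hoch_bullet alpha p n (i + q).-1 f x))).
- by move=> c y z; rewrite !hoch_bullet_linear.
- by move=> c y z; rewrite !hoch_bullet_linear.
(* The domains give [p + q <= n + 2], so the truncated subtractions in the two degrees agree. *)
- by move: dg df; rewrite /bullet_dom; lia.
move=> a; rewrite !hoch_bullet_ptens //; do 2!eexists; split; [by []..|].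
by move=> s _; apply: ins_term_ltC => //; [case/and3P: df|case/and3P: dg].
Qed.

Lemma hoch_bullet_comp p q n i j (f : cochain alpha p) (g : cochain alpha q)
    (x : hoch_chains A n) :
  bullet_dom q n j -> bullet_dom p (n.+1 - q) i ->
  (i <= j)%N -> (j < i + p)%N ->
  hoch_bullet alpha p _ i f (hoch_bullet alpha q n j g x)
    =[hoch_chains A]=
  hoch_bullet alpha _ n i (hoch_comp (j - i).+1 f g) x.
Proof.
move=> dg df ij jp.
have dfg : bullet_dom (p + q).-1 n i by move: dg df; rewrite /bullet_dom; lia.
apply: (eq_chains_fam
  (u := fun x => hoch_bullet alpha p _ i f (hoch_bullet alpha q n j g x))
  (v := hoch_bullet alpha _ n i (hoch_comp (j - i).+1 f g))).
- by move=> c y z; rewrite !hoch_bullet_linear.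
- exact: hoch_bullet_linear.
- by move: dg df; rewrite /bullet_dom; lia.
move=> a; rewrite !hoch_bullet_ptens //; do 2!eexists; split; [by []..|].
by move=> s _; apply: ins_term_comp => //; case/and3P: dg.
Qed.

Lemma hoch_bullet_id n i (x : hoch_chains A n) : (i <= n)%N ->
  hoch_bullet alpha 1 n i (hoch_id alpha) x =[hoch_chains A]= x.
Proof.
move=> i_n; have d1 : bullet_dom 1 n i by rewrite /bullet_dom; lia.
apply: (eq_chains_fam (u := hoch_bullet alpha 1 n i (hoch_id alpha)) (v := id)).
- exact: hoch_bullet_linear.
- by [].
- lia.
move=> a; rewrite hoch_bullet_ptens //; do 2!eexists; split; [by []..|].
(* Arity 1 gives the exponent 0 of [alpha] and no shift. *)
move=> s _; rewrite /ins_term hoch_idE /= !addn0.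
by case: ltnP => // _; case: eqP => [->|].
Qed.

Lemma hoch_t_linear n : linear (@hoch_t k A n).
Proof. exact/tlift_linear/hoch_t_multilinear. Qed.

(** This closed form of the rotation makes the induction go through; at [m = n.+1] only the first
    branch is left, and it is the identity. *)
Lemma iter_hoch_tE n m a : (m <= n.+1)%N ->
  iter m (hoch_t n) (ptens n.+1 a)
    = ptens n.+1 (fun s => if (s < m)%N then a (n.+1 - m + s)%N else a (s - m)%N).
Proof.
elim: m => [|m IH] mn; first by apply: eq_ptens => s _; rewrite !subn0.
rewrite iterS IH ?hoch_tE; last exact: ltnW.
apply: eq_ptens => -[|s] sn; last by rewrite ltnS; case: ifP => sm; congr a; lia.
(* Slot 0 receives the former slot [n], which is not yet in the rotated front block because
   [m <= n]. *)
by rewrite ifF; [congr a|]; lia.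
Qed.

Lemma hoch_t_order n (x : hoch_chains A n) : iter n.+1 (hoch_t n) x = x.
Proof.
have L m : linear (iter m (@hoch_t k A n)).
  by elim: m => [|m IH] c y z //=; rewrite IH hoch_t_linear.
move: x; apply: (tpow_extP (L n.+1)) => // a.
by rewrite iter_hoch_tE //; apply: eq_ptens => s ->; rewrite subnn.
Qed.

(** The bound [i + p <= n] keeps the last factor out of the block of [f], so it only acquires a
    power of [alpha], whether it is rotated before or after the insertion. *)
Lemma hoch_t_bullet p n i (f : cochain alpha p) (x : hoch_chains A n) :
  (0 < p)%N -> (i + p <= n)%N ->
  hoch_t _ (hoch_bullet alpha p n i f x)
    = hoch_bullet alpha p n i.+1 f (hoch_t n x).
Proof.
move=> p0 ipn.
have df : bullet_dom p n i by rewrite /bullet_dom; lia.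
have df' : bullet_dom p n i.+1 by rewrite /bullet_dom; lia.
move: x; apply: tpow_extP => [c y z|c y z|a].
- by rewrite hoch_bullet_linear ?hoch_t_linear.
- by rewrite hoch_t_linear hoch_bullet_linear.
rewrite hoch_bullet_ptens // !hoch_tE hoch_bullet_ptens //.
apply: eq_ptens => -[|s] sn; rewrite /ins_term.
  (* On the left, slot 0 is the last slot [n + 1 - p] of the insertion; it lies beyond [i] and reads
     factor [(n + 1 - p) + (p - 1) = n]. *)
  rewrite ltn0Sn ifF ?ifF; try lia.
  by congr (iter _ _ (a _)); lia.
by rewrite ltnS eqSS.
Qed.

End CyclicCompModule.

Theorem proposition3p4 (k : comNzRingType)
    (char_k : forall m : nat, m%:R = 0 :> k -> m = 0%N)
    (A : lmodType k) (mu : A -> A -> A) (alpha : {linear A -> A})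
    (homA : is_hom_assoc mu alpha) :
  is_cyclic_comp_module (O := hoch_operad alpha) (M := hoch_chains A)
    (hoch_bullet alpha) hoch_t.
Proof.
split.
- exact: hoch_bullet_bilinear.
- exact: hoch_t_linear.
- exact: hoch_bullet_lt.
- exact: hoch_bullet_comp.
(* This is hoch_bullet_lt with the roles of f and g exchanged. *)
- move=> p q n i j f g x dg df ipj; apply/esym.
  have [dg' df'] : bullet_dom q (n.+1 - p) (j - p).+1 /\ bullet_dom p n i.
    by move: dg df; rewrite /bullet_dom; lia.
  have ij : (i < (j - p).+1)%N by lia.
  have := hoch_bullet_lt g f x df' dg' ij.
  by have -> : ((j - p).+1 + p).-1 = j by lia.
- exact: hoch_bullet_id.
- by move=> n x _; apply: hoch_t_order.
- exact: hoch_t_bullet.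
Qed.
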